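(* Let $H$ be a matching covered hypergraph. Every tight cut decomposition $H_1,\ldots,H_i$ of $H$ corresponds to a maximal family $\mathcal{F}\subseteq\{S\subseteq V(H):\delta_H(S)\text{ is a non-trivial tight cut}\}$ such that any two members of $\mathcal{F}$ are laminar. That is: for any run of the tight cut decomposition procedure on $H$ producing $H_1,\ldots,H_i$, the subsets of $V(H)$ represented by the vertex sets chosen during the run form a family of pairwise laminar sets defining non-trivial tight cuts of $H$, and this family is maximal (under inclusion, with a set and its complement regarded as the same member) among all families of pairwise laminar sets defining non-trivial tight cuts of $H$.
   Context: A hypergraph $H$ has a finite vertex set $V(H)$ and a finite family $E(H)$ of non-empty subsets of $V(H)$, called edges; parallel edges are allowed. A perfect matching of $H$ is a set $M$ of edges such that every vertex lies in exactly one edge of $M$. $H$ is matching covered if it is connected, $|E(H)|\geq 1$, and every edge lies in a perfect matching. For $S\subseteq V(H)$ put $\overline{S}=V(H)\setminus S$, and let $\delta_H(S)$ be the family of edges meeting both $S$ and $\overline S$. The cut $\delta_H(S)$ is tight if $|M\cap\delta_H(S)|=1$ for every perfect matching $M$ of $H$; it is trivial if $|S|=1$ or $|\overline S|=1$, and non-trivial otherwise. Two sets $S,T\subseteq V(H)$ cross if all four sets $S\cap T$, $S\cap\overline T$, $\overline S\cap T$, $\overline S\cap\overline T$ are non-empty; otherwise they are laminar. Tight cut contractions: let $\delta_H(S)$ be a tight cut and let $s,\overline s\notin V(H)$ be new vertices. For $e\in\delta_H(S)$ put $e_s=(e\setminus S)\cup\{s\}$ and $e_{\overline s}=(e\cap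 S)\cup\{\overline s\}$. Then $H_S$ has vertex set $\{s\}\cup\overline S$ and edges $\{e\in E(H): e\subseteq\overline S\}\cup\{e_s:e\in\delta_H(S)\}$, and $H_{\overline S}$ has vertex set $\{\overline s\}\cup S$ and edges $\{e\in E(H):e\subseteq S\}\cup\{e_{\overline s}:e\in\delta_H(S)\}$ (each $e\in\delta_H(S)$ gives its own edge). Tight cut decomposition procedure: start with the list consisting of $H$ alone. While some hypergraph $H_j$ in the list has a non-trivial tight cut, choose any such $H_j$ and any $S\subseteq V(H_j)$ defining a non-trivial tight cut of $H_j$, and replace $H_j$ by the two hypergraphs $(H_j)_S$ and $(H_j)_{\overline S}$. The procedure ends when no hypergraph in the list has a non-trivial tight cut; the resulting list is called a tight cut decomposition of $H$. Represented sets: each vertex of a hypergraph occurring in the procedure represents a non-empty subset of $V(H)$: an original vertex $v$ represents $\{v\}$; when $H_j$ is contracted along $S$, the new vertex $s$ of $(H_j)_S$ represents the union of the sets represented by the vertices in $S$, and the new vertex $\overline s$ of $(H_j)_{\overline S}$ represents the union of the sets represented by the vertices in $V(H_j)\setminus S$. A set of vertices of $H_j$ represents the union of the sets represented by its elements. *)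

(* Defs.v *)
From mathcomp Require Import all_boot.

Set Implicit Arguments.
Unset Strict Implicit.
Unset Printing Implicit Defensive.

(* Edges are indexed by a finite type, so that parallel edges are allowed. *)
Record hypergraph := Hypergraph {
  vert : finType;
  edge : finType;
  ends : edge -> {set vert};
  ends_neq0 : forall e : edge, ends e != set0
}.

Section Hypergraph.
Variable H : hypergraph.
Implicit Types (S T : {set vert H}) (M : {set edge H}).

Definition perfect_matching M : Prop :=
  forall v : vert H, #|[set e in M | v \in ends e]| = 1.

Definition adjacent : rel (vert H) :=
  [rel u v | [exists e : edge H, (u \in ends e) && (v \in ends e)]].

Definition connected_hypergraph : Prop :=
  forall u v : vert H, connect adjacent u v.

Definition matching_covered : Prop :=
  [/\ connected_hypergraph,
      1 <= #|edge H| &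
      forall e : edge H, exists2 M, perfect_matching M & e \in M].

Definition cut S : {set edge H} :=
  [set e | (ends e :&: S != set0) && (ends e :&: ~: S != set0)].

Definition tight S : Prop :=
  forall M, perfect_matching M -> #|M :&: cut S| = 1.

Definition trivial_cut S : bool := (#|S| == 1) || (#|~: S| == 1).

Definition nontrivial_tight S : Prop := tight S /\ ~~ trivial_cut S.

Definition cross S T : bool :=
  [&& S :&: T != set0, S :&: ~: T != set0,
      ~: S :&: T != set0 & ~: S :&: ~: T != set0].

Definition laminar S T : bool := ~~ cross S T.

Definition laminar_tight_family (F : {set {set vert H}}) : Prop :=
  (forall S, S \in F -> nontrivial_tight S) /\
  {in F &, forall S T, laminar S T}.

(* Inclusion of families, a set and its complement being the same member. *)
Definition subfamily (F G : {set {set vert H}}) : Prop :=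
  forall S, S \in F -> (S \in G) || (~: S \in G).

Definition maximal_laminar_tight_family (F : {set {set vert H}}) : Prop :=
  laminar_tight_family F /\
  forall G : {set {set vert H}},
    laminar_tight_family G -> subfamily F G -> subfamily G F.

End Hypergraph.

Section Contraction.
Variables (H : hypergraph) (S : {set vert H}).

(* [None] is the new vertex s. *)
Definition contract_vert : finType := option {v : vert H | v \in ~: S}.

Definition contract_edge : finType :=
  {e : edge H | (ends e \subset ~: S) || (e \in cut S)}.

Definition contract_ends (e : contract_edge) : {set contract_vert} :=
  [set x : contract_vert |
     if x is Some v then val v \in ends (val e) else val e \in cut S].

Lemma contract_ends_neq0 (e : contract_edge) : contract_ends e != set0.
Proof.
apply/set0Pn; case: (boolP (val e \in cut S)) => [eS|eNS].
  by exists None; rewrite inE.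
have eC : ends (val e) \subset ~: S.
  by have := valP e; rewrite (negPf eNS) orbF.
have /set0Pn[v ve] := ends_neq0 (val e).
by exists (Some (exist _ v (subsetP eC v ve))); rewrite inE.
Qed.

(* The hypergraph H_S. As cut (~: S) = cut S, the other contraction, whose
   vertices are S and a new vertex representing ~: S, is [contract (~: S)]. *)
Definition contract : hypergraph := Hypergraph contract_ends_neq0.

End Contraction.

(* A hypergraph each of whose vertices represents a subset of V. *)
Record represented (V : finType) := Represented {
  rhyp : hypergraph;
  rep : vert rhyp -> {set V}
}.

Definition rep_set (V : finType) (G : represented V) (S : {set vert (rhyp G)}) :
    {set V} :=
  \bigcup_(u in S) rep u.

Definition rep_init (H : hypergraph) : represented (vert H) :=
  @Represented _ H (fun v => [set v]).

Definition rep_contract (V : finType) (G : represented V)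
    (S : {set vert (rhyp G)}) : represented V :=
  @Represented V (contract S)
    (fun x : contract_vert S => if x is Some v then rep (val v) else rep_set S).

(* [tcd_run l F]: some number of steps of the procedure started on H lead to
   the list l, and F consists of the subsets of V(H) represented by the vertex
   sets chosen in these steps. *)
Inductive tcd_run (H : hypergraph) :
    seq (represented (vert H)) -> {set {set vert H}} -> Prop :=
| tcd_start : tcd_run [:: rep_init H] set0
| tcd_step (l1 l2 : seq (represented (vert H))) (G : represented (vert H))
    (F : {set {set vert H}}) (S : {set vert (rhyp G)}) :
    tcd_run (l1 ++ G :: l2) F ->
    nontrivial_tight S ->
    tcd_run (l1 ++ [:: rep_contract S, rep_contract (~: S) & l2])
            (rep_set S |: F).

Definition tight_cut_decomposition (H : hypergraph)
    (l : seq (represented (vert H))) (F : {set {set vert H}}) : Prop :=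
  tcd_run l F /\
  forall (l1 l2 : seq (represented (vert H))) (G : represented (vert H)),
    l = l1 ++ G :: l2 ->
    forall S : {set vert (rhyp G)}, ~ nontrivial_tight S.

(* Main.v *)
(* A perfect matching of H restricts to H_S when the cut of S is tight, and
   conversely every perfect matching M' of H_S extends to H: if e is the cut
   edge of M', complete M' inside S by a perfect matching of H containing e.
   Hence the tight sets of H_S are exactly the tight sets of H that contain S
   or are disjoint from it. By induction, a hypergraph occurring in the procedure is a
   quotient of H by a partition of V(H) whose tight sets are the tight unions
   of classes. Any two hypergraphs of the list have classes covering V(H)
   together, and every set A already chosen has A or its complement inside a
   single class of each of them; so the chosen sets are laminar. Conversely, a
   tight set laminar to all the chosen ones survives in one of the hypergraphs
   of the list until it, or its complement, is itself chosen; it cannot survive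
   to the end. *)

From Stdlib Require Import List.
Require Import Defs.
From mathcomp Require Import all_boot.

Set Implicit Arguments.
Unset Strict Implicit.
Unset Printing Implicit Defensive.

(** The clause of [matching_covered] that is transported through contractions. *)
Definition covered_edges (H : hypergraph) : Prop :=
  forall e : edge H, exists2 M, perfect_matching M & e \in M.

(** * Complements, laminarity and tightness *)

Section Laminar.
Variable H : hypergraph.
Implicit Types S T : {set vert H}.

Lemma cutC S : cut (~: S) = cut S.
Proof. by apply/setP=> e; rewrite !inE setCK andbC. Qed.

Lemma tightC S : tight S -> tight (~: S).
Proof. by move=> tS M /tS; rewrite cutC. Qed.

(** Each side of the outer disjunction names a contraction, along [T] or along [~: T], in which [S]
    remains a union of classes. *)
Lemma laminarE S T : laminar S T =
  ((S :&: T == set0) || (T \subset S)) ||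
  ((S :&: ~: T == set0) || (~: T \subset S)).
Proof.
rewrite -(setD_eq0 T) -(setD_eq0 (~: T)) !setDE !(setIC _ (~: S)).
by rewrite /laminar /cross !negb_and !negbK -!orbA; congr (_ || _); rewrite orbCA.
Qed.

Lemma laminarC S T : laminar S T = laminar T S.
Proof.
rewrite /laminar /cross (setIC T S) (setIC T (~: S)).
rewrite (setIC (~: T) S) (setIC (~: T) (~: S)).
by congr (~~ (_ && _)); rewrite andbCA.
Qed.

Lemma laminarNr S T : laminar S (~: T) = laminar S T.
Proof.
rewrite /laminar /cross setCK; congr (~~ _).
by do 4 case: (_ != set0).
Qed.

Lemma subset_laminar S T : S \subset T -> laminar S T.
Proof. by rewrite laminarE -(setD_eq0 S) setDE => ->; rewrite !orbT. Qed.

Lemma laminar_refl S : laminar S S.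
Proof. exact: subset_laminar. Qed.

Lemma tight_neq0 S (M : {set edge H}) :
  perfect_matching M -> tight S -> S != set0.
Proof.
move=> pM /(_ M pM) MS; apply: contra_eq_neq MS => ->.
rewrite (_ : cut _ = set0) ?setI0 ?cards0 //.
by apply/setP=> e; rewrite !inE setI0 eqxx.
Qed.

End Laminar.

(** * A single contraction: perfect matchings and tight sets *)

Section Contraction.
Variables (H : hypergraph) (S : {set vert H}).
Implicit Types (M : {set edge H}) (T : {set vert (contract S)}).

(** [insub] returns [None] exactly on [S], so this is the quotient map collapsing [S] to the new
    vertex. *)
Definition contract_proj (v : vert H) : vert (contract S) := insub v.

Lemma contract_proj_None v : (contract_proj v == None) = (v \in S).
Proof. by rewrite /contract_proj; case: insubP => [u|]; rewrite inE; case: (v \in S). Qed.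

Lemma contract_proj_Some v u : (contract_proj v == Some u) = (v == val u).
Proof.
rewrite /contract_proj; case: insubP => [w _ <-|vS].
  by apply/eqP/eqP => [[->]|/val_inj ->].
by apply/esym/negbTE; apply: contraNneq vS => ->; exact: valP.
Qed.

Lemma contract_proj_surj x : S != set0 -> exists v, contract_proj v = x.
Proof.
case: x => [u|] => [_|/set0Pn[v vS]].
  by exists (val u); apply/eqP; rewrite contract_proj_Some.
by exists v; apply/eqP; rewrite contract_proj_None.
Qed.

Lemma contract_endsE (e : edge (contract S)) :
  ends e = contract_proj @: ends (val e).
Proof.
apply/setP=> -[u|]; rewrite inE; apply/idP/imsetP.
- by move=> ue; exists (val u) => //; apply/esym/eqP; rewrite contract_proj_Some.
- by case=> v ve /esym/eqP; rewrite contract_proj_Some => /eqP <-.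
- rewrite inE => /andP[/set0Pn[v /setIP[ve vS]] _].
  by exists v => //; apply/esym/eqP; rewrite contract_proj_None.
case=> v ve /esym/eqP; rewrite contract_proj_None => vS.
have /orP[/subsetP/(_ v ve)|//] := valP e.
by rewrite inE vS.
Qed.

(** These are the edges lost in [contract S]. Non-emptiness of edges matters: an empty edge would
    lie inside both [S] and its complement. *)
Lemma contract_edgeN (e : edge H) :
  ~~ ((ends e \subset ~: S) || (e \in cut S)) = (ends e \subset S).
Proof.
rewrite -disjoints_subset -setI_eq0 -(setCK S) -disjoints_subset -setI_eq0.
rewrite inE !setCK negb_or negb_and !negbK.
have [eS|//] := eqVneq (ends e :&: S) set0.
apply/esym/negbTE; apply: contra_neqN (ends_neq0 e) => /eqP eC.
by rewrite -(setIT (ends e)) -(setUCr S) setIUr eS eC setU0.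
Qed.

Definition restrict_matching M : {set edge (contract S)} :=
  [set e | val e \in M].

Lemma card_restrict_matching M (P : pred (edge H)) :
    (forall e, e \in M -> P e -> ~~ (ends e \subset S)) ->
  #|[set e in restrict_matching M | P (val e)]| = #|[set e in M | P e]|.
Proof.
move=> PS; rewrite -(card_imset _ val_inj); apply: eq_card => e.
apply/imsetP/idP => [[f]|].
  by rewrite !inE => /andP[fM Pf] ->; apply/andP.
rewrite inE => /andP[eM Pe]; have := PS _ eM Pe.
rewrite -contract_edgeN negbK => eP.
by exists (exist _ e eP); rewrite ?inE //=; apply/andP.
Qed.

(** Degrees at old vertices do not change; the degree of the new vertex is the number of cut edges
    of [M], which tightness makes 1. *)
Lemma perfect_matching_restrict M :
  tight S -> perfect_matching M -> perfect_matching (restrict_matching M).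
Proof.
move=> tS pM [u|].
  rewrite -(pM (val u)) -(@card_restrict_matching M (fun e => val u \in ends e)).
    by apply: eq_card => e; rewrite !inE.
  move=> e _ ue; apply/subsetPn; exists (val u) => //.
  by have := valP u; rewrite inE.
rewrite -(tS M pM) (_ : M :&: cut S = [set e in M | e \in cut S]); last first.
  by apply/setP=> e; rewrite !inE.
rewrite -card_restrict_matching.
  by apply: eq_card => e; rewrite !inE.
move=> e _; rewrite inE => /andP[_ /set0Pn[v /setIP[ve vS]]].
by apply/subsetPn; exists v => //; rewrite -in_setC.
Qed.

Lemma perfect_matching_extend (M' : {set edge (contract S)}) :
    covered_edges H -> tight S -> perfect_matching M' ->
  exists2 M, perfect_matching M & restrict_matching M = M'.
Proof.
move=> cH tS pM'; have /eqP/cards1P[e0 e0E] := pM' None.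
have /setIdP[e0M' e0N] : e0 \in [set e in M' | None \in ends e].
  by rewrite e0E set11.
have [M0 pM0 e0M0] := cH (val e0).
have {}e0N : val e0 \in cut S by move: e0N; rewrite inE.
have /eqP/cards1P[e1 e1E] := tS _ pM0.
have e1P : e1 = val e0.
  by apply/esym/set1P; rewrite -e1E inE e0M0.
move: e1E; rewrite {}e1P => e1E {e1}.
(* Glue [M0] inside [S] with [M'] outside; the common cut edge comes from [M']. *)
pose M := [set e in M0 | ends e \subset S] :|: val @: M'.
(* An edge of [M'] reaching into [S] contains the new vertex, hence is [e0]. *)
have MS e v : v \in ends e -> v \in S -> (e \in val @: M') = (e == val e0).
  move=> ve vS; apply/imsetP/eqP => [[f fM' eE]|->]; last by exists e0.
  rewrite eE; congr val; apply/set1P; rewrite -e0E inE fM' inE /=.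
  have /orP[/subsetP/(_ v)|//] := valP f.
  by rewrite -eE ve inE vS => /(_ isT).
have rM : restrict_matching M = M'.
  apply/setP=> e; rewrite inE in_setU mem_imset; last exact: val_inj.
  by rewrite inE -contract_edgeN (valP e) andbF.
exists M => // v; have [vS|vS] := boolP (v \in S).
  rewrite -(pM0 v); apply: eq_card => e; rewrite inE [RHS]inE.
  have [ve|//] := boolP (v \in ends e); rewrite ?andbF // !andbT.
  rewrite in_setU (MS _ _ ve vS) inE.
  have := in_setI e M0 (cut S); rewrite e1E in_set1 => ->.
  have := contract_edgeN e; rewrite (_ : _ \subset ~: S = false); last first.
    by apply/negbTE/subsetPn; exists v => //; rewrite inE vS.
  by move=> <- /=; case: (e \in M0); case: (e \in cut S).
have vC : v \in ~: S by rewrite inE.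
rewrite -(pM' (Some (exist _ v vC))) -rM.
rewrite -(@card_restrict_matching M (fun e => v \in ends e)).
  by apply: eq_card => e; rewrite !inE.
by move=> e _ ve; apply/subsetPn; exists v.
Qed.

Lemma cut_contract T (e : edge (contract S)) :
  (e \in cut T) = (val e \in cut (contract_proj @^-1: T)).
Proof.
have meet (X : {set vert (contract S)}) :
    (ends e :&: X != set0) = (ends (val e) :&: contract_proj @^-1: X != set0).
  rewrite contract_endsE; apply/set0Pn/set0Pn => -[x /setIP[]].
    by case/imsetP=> v ve -> vX; exists v; rewrite !inE ve.
  by rewrite inE => xe xX; exists (contract_proj x); rewrite inE imset_f.
by rewrite !inE !meet preimsetC.
Qed.

(** No cut edge is lost by restriction: an edge inside [S] collapses to the new vertex, so it cannot
    meet both a preimage and its complement. *)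
Lemma card_restrict_cut M T :
  #|restrict_matching M :&: cut T| = #|M :&: cut (contract_proj @^-1: T)|.
Proof.
pose P (e : edge H) := e \in cut (contract_proj @^-1: T).
rewrite (_ : _ :&: cut T = [set e in restrict_matching M | P (val e)]).
  rewrite card_restrict_matching; first by apply: eq_card => e; rewrite !inE.
  move=> e _; rewrite /P inE -preimsetC.
  case/andP=> /set0Pn[u /setIP[ue uT]] /set0Pn[v /setIP[ve vT]].
  apply/negP=> /subsetP eS; move: uT vT; rewrite !inE.
  have /eqP-> : contract_proj u == None by rewrite contract_proj_None eS.
  have /eqP-> : contract_proj v == None by rewrite contract_proj_None eS.
  by move=> ->.
by apply/setP=> e; rewrite in_setI [RHS]inE cut_contract.
Qed.

(** Restriction preserves the number of cut edges, and by extension it reaches every perfect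
    matching of [contract S]. *)
Lemma tight_contract T : covered_edges H -> tight S ->
  tight T <-> tight (contract_proj @^-1: T).
Proof.
move=> cH tS; split=> tT M pM.
  by rewrite -card_restrict_cut tT //; exact: perfect_matching_restrict.
have [M0 pM0 <-] := perfect_matching_extend cH tS pM.
by rewrite card_restrict_cut tT.
Qed.

Lemma covered_edges_contract :
  covered_edges H -> tight S -> covered_edges (contract S).
Proof.
move=> cH tS e; have [M pM eM] := cH (val e).
exists (restrict_matching M); last by rewrite inE.
exact: perfect_matching_restrict.
Qed.

Lemma contract_proj_preimset1 x :
  contract_proj @^-1: [set x] = if x is Some v then [set val v] else S.
Proof.
case: x => [u|]; apply/setP=> v; rewrite !inE.
  exact: contract_proj_Some.
exact: contract_proj_None.
Qed.

Lemma nontrivial_tight_contract (X : {set vert H}) :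
    covered_edges H -> tight S -> nontrivial_tight X ->
    (X :&: S == set0) || (S \subset X) ->
  [\/ X = S, X = ~: S | exists2 T : {set vert (contract S)},
        nontrivial_tight T & contract_proj @^-1: T = X].
Proof.
move=> cH tS [tX /norP[X1 XC1]] XS.
pose T := contract_proj @: X.
have TX : contract_proj @^-1: T = X.
  apply/setP=> v; rewrite inE; apply/imsetP/idP => [[w wX vw]|vX]; last by exists v.
  have [vS|vS] := boolP (v \in S).
    have wS : w \in S by rewrite -contract_proj_None -vw contract_proj_None.
    case/orP: XS => [/eqP/setP/(_ w)|/subsetP/(_ v vS) //].
    by rewrite !inE wX wS.
  have vC : v \in ~: S by rewrite inE.
  move/esym/eqP: vw; rewrite /contract_proj (insubT (fun v => v \in ~: S) vC).
  by rewrite (contract_proj_Some w (Sub v vC)) /= => /eqP <-.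
(* Contraction may make the cut trivial. As [X] is non-trivial, a singleton [T] or [~: T] can only
   be the new vertex, which means [X = S] or [X = ~: S]. *)
have [/orP[]|nT] := boolP (trivial_cut T).
- case/cards1P=> x Tx; move: TX X1; rewrite Tx contract_proj_preimset1.
  by case: x {Tx} => [u <-|SX _]; [rewrite cards1 | apply/Or31/esym].
- case/cards1P=> x Tx; move: (congr1 (fun Y => ~: Y) TX) XC1.
  rewrite -preimsetC Tx contract_proj_preimset1.
  case: x {Tx} => [u <-|SX _]; first by rewrite cards1.
  by apply: Or32; rewrite SX setCK.
by apply: Or33; exists T => //; split=> //; apply/tight_contract; rewrite ?TX.
Qed.

End Contraction.

(** * Hypergraphs of a run as quotients of [H] *)

Section Represented.
Variable H : hypergraph.
Implicit Types (G : represented (vert H)) (l : seq (represented (vert H))).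
Implicit Types (A : {set vert H}) (F : {set {set vert H}}).

(** The classes are the fibres of [f]; surjectivity makes them non-empty, and a perfect matching
    makes tight sets non-empty. *)
Definition tight_quotient G (f : vert H -> vert (rhyp G)) : Prop :=
  [/\ forall u, rep u = f @^-1: [set u],
      forall u, exists x, f x = u,
      covered_edges (rhyp G),
      exists M : {set edge (rhyp G)}, perfect_matching M &
      forall T, tight T <-> tight (f @^-1: T)].

Lemma tight_quotient_init :
  matching_covered H -> @tight_quotient (rep_init H) id.
Proof.
case=> _ /card_gt0P[e _] cH; split=> // [u|u||T].
- by apply/setP=> v; rewrite !inE.
- by exists u.
- by have [M pM _] := cH e; exists M.
by rewrite (_ : _ @^-1: T = T) //; apply/setP=> v; rewrite inE.
Qed.

Section Quotient.
Variables (G : represented (vert H)) (f : vert H -> vert (rhyp G)).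
Hypothesis Gf : tight_quotient f.
Implicit Types S T : {set vert (rhyp G)}.

Lemma rep_setE S : rep_set S = f @^-1: S.
Proof.
case: Gf => repE _ _ _ _; apply/setP=> x; rewrite inE; apply/bigcupP/idP.
  by case=> u uS; rewrite repE !inE => /eqP->.
by move=> fS; exists (f x); rewrite // repE !inE.
Qed.

Lemma rep_setC S : rep_set (~: S) = ~: rep_set S.
Proof. by rewrite !rep_setE preimsetC. Qed.

Lemma rep_subset_rep_set u S : u \in S -> rep u \subset rep_set S.
Proof. exact: bigcup_sup. Qed.

Lemma rep_set_neq0 S : (rep_set S != set0) = (S != set0).
Proof.
case: Gf => _ fS _ _ _; rewrite rep_setE; apply/set0Pn/set0Pn => -[x].
  by rewrite inE; exists (f x).
by have [y <-] := fS x => yS; exists y; rewrite inE.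
Qed.

Lemma rep_setI S T : rep_set (S :&: T) = rep_set S :&: rep_set T.
Proof. by rewrite !rep_setE preimsetI. Qed.

Lemma card_rep_set S : #|S| <= #|rep_set S|.
Proof.
case: Gf => _ fS _ _ _; rewrite rep_setE.
apply: leq_trans (leq_imset_card f _); apply/subset_leq_card/subsetP => u uS.
by have [x fx] := fS u; apply/imsetP; exists x; rewrite // inE fx.
Qed.

Lemma nontrivial_tight_rep_set S :
  nontrivial_tight S -> nontrivial_tight (rep_set S).
Proof.
case: Gf => _ _ _ [M pM] tE [tS /norP[S1 SC1]]; split.
  by rewrite rep_setE; apply/tE.
(* A non-empty set that is not a singleton has two vertices, and these represent disjoint non-empty
   sets. *)
have card_gt1 (X : {set vert (rhyp G)}) : tight X -> #|X| != 1 -> #|rep_set X| != 1.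
  move=> /(tight_neq0 pM); rewrite -card_gt0 => X0 X1.
  rewrite gtn_eqF //; apply: leq_trans (card_rep_set X).
  by rewrite ltn_neqAle eq_sym X1.
by rewrite /trivial_cut -rep_setC negb_or !card_gt1 //; exact: tightC.
Qed.

Lemma tight_quotient_contract S :
  tight S -> @tight_quotient (rep_contract S) (@contract_proj _ S \o f).
Proof.
case: (Gf) => repE fS cG [M pM] tE tS; split.
- case=> [u|] /=; rewrite ?rep_setE ?repE; apply/setP=> x; rewrite !inE /=.
    by rewrite contract_proj_Some.
  by rewrite contract_proj_None.
- move=> x; have [u <-] := contract_proj_surj x (tight_neq0 pM tS).
  by have [y <-] := fS u; exists y.
- exact: covered_edges_contract.
- by exists (restrict_matching S M); exact: perfect_matching_restrict.
move=> T; rewrite (tight_contract T cG tS) tE.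
by rewrite (_ : (_ \o f) @^-1: T = f @^-1: (@contract_proj _ S @^-1: T)) //;
   apply/setP=> x; rewrite !inE.
Qed.

End Quotient.

(** * Survival of tight sets and separation of the hypergraphs in the list *)

Definition survives A G : Prop :=
  exists2 T : {set vert (rhyp G)}, nontrivial_tight T & rep_set T = A.

Lemma survives_contract G f (S : {set vert (rhyp G)}) A :
    @tight_quotient G f -> tight S -> survives A G ->
    (A :&: rep_set S == set0) || (rep_set S \subset A) ->
  [\/ A = rep_set S, A = ~: rep_set S | survives A (rep_contract S)].
Proof.
move=> Gf tS [X nX <-].
have -> : (rep_set X :&: rep_set S == set0) = (X :&: S == set0).
  by rewrite -(rep_setI Gf); apply: negb_inj; rewrite (rep_set_neq0 Gf).
have -> : (rep_set S \subset rep_set X) = (S \subset X).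
  rewrite -!setD_eq0 !setDE -(rep_setC Gf) -(rep_setI Gf).
  by apply: negb_inj; rewrite (rep_set_neq0 Gf).
case: (Gf) => _ _ cG _ _.
case/(nontrivial_tight_contract cG tS nX) => [->|->|[T nT TX]].
- exact: Or31.
- by rewrite (rep_setC Gf); exact: Or32.
apply: Or33; exists T => //.
rewrite (rep_setE (tight_quotient_contract Gf tS)) (rep_setE Gf) -TX.
by apply/setP=> x; rewrite !inE.
Qed.

(** Equivalently, some class of [G'] contains the complement of a class of [G]; this makes choices
    in [G] and in [G'] laminar. *)
Definition co_covering G G' : bool :=
  [exists u : vert (rhyp G), exists v : vert (rhyp G'), rep u :|: rep v == setT].

Definition confined A G : bool :=
  [exists u : vert (rhyp G), (A \subset rep u) || (~: A \subset rep u)].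

Lemma co_coveringC : symmetric co_covering.
Proof.
by move=> G G'; apply/existsP/existsP => -[u /existsP[v uv]]; exists v;
  apply/existsP; exists u; rewrite setUC.
Qed.

(** Contraction only merges classes, so [co_covering] and [confined] persist under it. *)
Lemma rep_sub_contract G (S : {set vert (rhyp G)}) (u : vert (rhyp G)) :
  exists v : vert (rhyp (rep_contract S)), rep u \subset rep v.
Proof.
have [uS|uS] := boolP (u \in S); first by exists None; exact: bigcup_sup.
have uC : u \in ~: S by rewrite inE.
by exists (Some (exist _ u uC)).
Qed.

Lemma co_covering_contract G (S : {set vert (rhyp G)}) G' :
  co_covering G G' -> co_covering (rep_contract S) G'.
Proof.
case/existsP=> u /existsP[v /eqP uv]; have [w uw] := rep_sub_contract S u.
apply/existsP; exists w; apply/existsP; exists v.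
by rewrite -subTset -uv setSU.
Qed.

Lemma co_covering_contracts G f (S : {set vert (rhyp G)}) :
  @tight_quotient G f -> co_covering (rep_contract S) (rep_contract (~: S)).
Proof.
move=> Gf; apply/existsP; exists None; apply/existsP; exists None => /=.
by rewrite (rep_setC Gf) setUCr.
Qed.

Lemma confined_contract G (S : {set vert (rhyp G)}) A :
  confined A G -> confined A (rep_contract S).
Proof.
case/existsP=> u Au; have [w uw] := rep_sub_contract S u.
by apply/existsP; exists w; case/orP: Au => /subset_trans->; rewrite ?orbT.
Qed.

(** The represented set is a union of classes, so it contains or avoids the class holding [A] or its
    complement. *)
Lemma confined_rep_set G f (S : {set vert (rhyp G)}) A :
  @tight_quotient G f -> confined A G -> laminar A (rep_set S).
Proof.
move=> Gf /existsP[u Au].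
wlog uS : S / u \in S => [th|].
  have [|uS] := boolP (u \in S); first exact: th.
  by rewrite -laminarNr -(rep_setC Gf) th // inE.
case/orP: Au => /subset_trans/(_ (rep_subset_rep_set uS))/subset_laminar //.
by rewrite laminarC laminarNr laminarC.
Qed.

(** Whichever of [S] and [~: S] misses [u] is represented outside [rep u], hence inside [rep v]. *)
Lemma confined_co_covering G f (S : {set vert (rhyp G)}) G' :
  @tight_quotient G f -> co_covering G G' -> confined (rep_set S) G'.
Proof.
move=> Gf /existsP[u /existsP[v uv]]; apply/existsP; exists v.
have sub (T : {set vert (rhyp G)}) : u \notin T -> rep_set T \subset rep v.
  move=> uT; apply: subset_trans (_ : ~: rep u \subset _).
    rewrite subsetC -(rep_setC Gf); apply: rep_subset_rep_set.
    by rewrite inE.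
  by rewrite -subTset in uv; rewrite -setTD subDset.
have [uS|uS] := boolP (u \in S); last by rewrite sub.
by rewrite -(rep_setC Gf) (sub (~: S)) ?orbT ?inE ?uS.
Qed.

(** * Invariants of a run *)

Lemma tcd_run_quotient l F : matching_covered H -> tcd_run l F ->
  Forall (fun G => exists f, @tight_quotient G f) l.
Proof.
move=> mH; elim=> [|l1 l2 G F' S _ /Forall_app[Fl1 /Forall_cons_iff[[f Gf] Fl2]] [tS _]].
  by constructor=> //; exists id; exact: tight_quotient_init.
apply/Forall_app; split=> //; apply/Forall_cons_iff; split.
  by eexists; exact: (tight_quotient_contract Gf tS).
apply/Forall_cons_iff; split=> //.
by eexists; exact: (tight_quotient_contract Gf (tightC tS)).
Qed.

(** The two new hypergraphs co-cover through their new vertices; against the rest of the list they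
    inherit the property from [G]. *)
Lemma tcd_run_co_covering l F :
  matching_covered H -> tcd_run l F -> pairwise co_covering l.
Proof.
move=> mH; elim=> [//|l1 l2 G F' S run IH _].
have /Forall_app[_ /Forall_cons_iff[[f Gf] _]] := tcd_run_quotient mH run.
move: IH; rewrite !pairwise_cat /= !allrel_consr.
case/and3P=> /andP[l1G ->] -> /andP[Gl2 ->]; rewrite /= !andbT.
have contr (T : {set vert (rhyp G)}) k :
    all (co_covering G) k -> all (co_covering (rep_contract T)) k.
  by apply: sub_all => G'; exact: co_covering_contract.
have contl (T : {set vert (rhyp G)}) k :
    all (co_covering ^~ G) k -> all (co_covering ^~ (rep_contract T)) k.
  apply: sub_all => G'; rewrite !(co_coveringC G').
  exact: co_covering_contract.
by rewrite !contr // !contl // (co_covering_contracts _ Gf).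
Qed.

(** A freshly chosen set is confined by the new vertices of both contractions, and elsewhere because
    [G] co-covers with every other hypergraph. *)
Lemma tcd_run_confined l F A :
  matching_covered H -> tcd_run l F -> A \in F -> all (confined A) l.
Proof.
move=> mH run; elim: run A => [A|l1 l2 G F' S run IH _ A]; first by rewrite inE.
have /Forall_app[_ /Forall_cons_iff[[f Gf] _]] := tcd_run_quotient mH run.
rewrite all_cat /= => /setU1P[->|/IH]; last first.
  by rewrite all_cat /= => /and3P[-> AG ->]; rewrite !confined_contract.
have := tcd_run_co_covering mH run.
rewrite pairwise_cat /= allrel_consr => /and3P[/andP[l1G _] _ /andP[Gl2 _]].
apply/and4P; split.
- apply: sub_all l1G => G'; rewrite co_coveringC.
  exact: confined_co_covering Gf.
- by apply/existsP; exists None => /=; rewrite subxx.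
- by apply/existsP; exists None => /=; rewrite (rep_setC Gf) subxx orbT.
by apply: sub_all Gl2 => G'; exact: confined_co_covering Gf.
Qed.

Lemma tcd_run_laminar l F :
  matching_covered H -> tcd_run l F -> laminar_tight_family F.
Proof.
move=> mH; elim=> [|l1 l2 G F' S run [IHt IHl] nS].
  by split=> [A|A B]; rewrite inE.
have /Forall_app[_ /Forall_cons_iff[[f Gf] _]] := tcd_run_quotient mH run.
have lamS A : A \in F' -> laminar A (rep_set S).
  move=> /(tcd_run_confined mH run); rewrite all_cat /= => /and3P[_ AG _].
  exact: confined_rep_set Gf AG.
split=> [A /setU1P[->|/IHt //]|A B]; first exact: nontrivial_tight_rep_set Gf S nS.
case/setU1P=> [->|AF] /setU1P[->|BF].
- exact: laminar_refl.
- by rewrite laminarC lamS.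
- exact: lamS.
exact: IHl.
Qed.

(** If [A] survives in the hypergraph being contracted, laminarity with the chosen set puts it in
    one of the two contractions, unless it equals that set up to complement. *)
Lemma tcd_run_survives l F A :
    matching_covered H -> tcd_run l F ->
    nontrivial_tight A -> {in F, forall B, laminar A B} ->
  [\/ A \in F, ~: A \in F | Exists (survives A) l].
Proof.
move=> mH run nA; elim: run => [_|l1 l2 G F' S run IH nS lamA].
  apply/Or33/Exists_cons_hd; exists A => //.
  by apply/setP=> v; rewrite (rep_setE (tight_quotient_init mH)) inE.
have /Forall_app[_ /Forall_cons_iff[[f Gf] _]] := tcd_run_quotient mH run.
have [|AF|AF|] := IH.
- by move=> B BF; apply: lamA; rewrite inE BF orbT.
- by apply: Or31; rewrite inE AF orbT.
- by apply: Or32; rewrite inE AF orbT.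
move=> /Exists_app[sA|/Exists_cons[sA|sA]].
- by apply/Or33/Exists_app; left.
- have [tS _] := nS.
  have : laminar A (rep_set S) by apply: lamA; rewrite setU11.
  have step (T : {set vert (rhyp G)}) : tight T ->
      (A :&: rep_set T == set0) || (rep_set T \subset A) ->
      [\/ A = rep_set T, A = ~: rep_set T | survives A (rep_contract T)].
    by move=> tT; exact: survives_contract Gf tT sA.
  rewrite laminarE -(rep_setC Gf) => /orP[/(step S tS)|].
    case=> [->|->|sS]; first by apply: Or31; rewrite setU11.
      by apply: Or32; rewrite setCK setU11.
    by apply/Or33/Exists_app; right; apply: Exists_cons_hd.
  move/(step _ (tightC tS)); rewrite (rep_setC Gf) setCK.
  case=> [->|->|sS]; last first.
  + by apply/Or33/Exists_app; right; apply/Exists_cons_tl/Exists_cons_hd.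
  + by apply: Or31; rewrite setU11.
  by apply: Or32; rewrite setCK setU11.
by apply/Or33/Exists_app; right; do 2 apply: Exists_cons_tl.
Qed.

End Represented.

Theorem corollary2p2 (H : hypergraph) (l : seq (represented (vert H)))
    (F : {set {set vert H}}) :
  matching_covered H ->
  tight_cut_decomposition l F ->
  maximal_laminar_tight_family F.
Proof.
move=> mH [run final]; split; first exact: tcd_run_laminar run.
move=> G [nG lamG] FG A AG.
have lamA : {in F, forall B, laminar A B}.
  (* A member of [F] lies in [G] up to complement, which does not affect laminarity. *)
  by move=> B /FG/orP[] /(lamG _ _ AG) //; rewrite laminarNr.
have [->|->|] := tcd_run_survives mH run (nG _ AG) lamA; rewrite ?orbT //.
(* Survival to the end would leave a non-trivial tight cut in the final list. *)
case/Exists_exists=> G' [G'l [T nT _]].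
have [l1 [l2 lE]] := in_split _ _ G'l.
by case: (final _ _ _ lE T nT).
Qed.
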